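(* Let $M$ be a lightlike hypersurface of an indefinite statistical manifold $(\overline{M},\overline{g},\overline{\nabla},\overline{\nabla}^{*})$, with screen distribution $S(TM)$, radical distribution $\mathrm{Rad}(TM)$ spanned by $\xi$, and induced connections $\nabla$ and $\nabla^{*}$. Suppose that both $\mathrm{Rad}(TM)$ and $S(TM)$ are parallel with respect to both $\nabla$ and $\nabla^{*}$. Then $$K(W,\xi)=K(\xi,W)=0\qquad\text{for all } W\in\Gamma(S(TM)).$$ Moreover, for all $X,Y\in\Gamma(TM)$, $$K(X,Y)=K(PX,PY)+\eta(X)\eta(Y)K(\xi,\xi),$$ where $K(PX,PY)\in\Gamma(S(TM))$ and $K(\xi,\xi)\in\Gamma(\mathrm{Rad}(TM))$. In addition, $$(\tau-\tau^{*})|_{S(TM)}=0,\qquad \tau-\tau^{*}=\{\tau(\xi)-\tau^{*}(\xi)\}\eta.$$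
   Context: $\Gamma(E)$ denotes smooth sections of $E$. An indefinite statistical manifold $(\overline{M},\overline{g},\overline{\nabla},\overline{\nabla}^{*})$ is a semi-Riemannian manifold $(\overline M,\overline g)$ with a torsion-free affine connection $\overline\nabla$ satisfying the Codazzi condition $(\overline{\nabla}_{X}\overline{g})(Y,Z)=(\overline{\nabla}_{Y}\overline{g})(X,Z)$, together with the dual connection $\overline\nabla^{*}$ determined by $X\overline{g}(Y,Z)=\overline{g}(\overline{\nabla}_{X}Y,Z)+\overline{g}(Y,\overline{\nabla}^{*}_{X}Z)$ (which is then also torsion-free). $M$ is a lightlike hypersurface: $M$ has codimension one and the induced metric $g$ is degenerate, so $\mathrm{Rad}(TM)=TM\cap TM^{\perp}=TM^{\perp}$ is a rank-one bundle. A screen distribution $S(TM)$ is a non-degenerate distribution complementary to $\mathrm{Rad}(TM)$ in $TM$; one is fixed. Fix a nowhere-zero section $\xi$ of $\mathrm{Rad}(TM)$ (in general it exists only locally, and all objects depending on it are understood on its domain). $N$ is the unique vector field along $M$ with $\overline{g}(N,N)=0$, $\overline{g}(N,\xi)=1$, $\overline{g}(N,W)=0$ for all $W\in\Gamma(S(TM))$; then $T\overline M|_M=TM\oplus\mathrm{span}\{N\}$. $P$ is the projection of $TM$ onto $S(TM)$ along $\mathrm{Rad}(TM)$ and $\eta(X)=\overline g(X,N)$, so $X=PX+\eta(X)\xi$ for $X\in\Gamma(TM)$. For $X,Y\in\Gamma(TM)$ the Gauss formulas $\overline{\nabla}_{X}Y=\nabla_{X}Y+B(X,Y)N$ and $\overline{\nabla}^{*}_{X}Y=\nabla^{*}_{X}Y+B^{*}(X,Y)N$,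 with $\nabla_XY,\nabla^*_XY\in\Gamma(TM)$, define the induced torsion-free connections $\nabla,\nabla^{*}$. The one-forms $\tau,\tau^{*}$ (and screen-valued operators $A_\xi,A_\xi^*:TM\to S(TM)$) are defined by $\nabla_{X}\xi=-A_{\xi}X-\tau(X)\xi$ and $\nabla^{*}_{X}\xi=-A^{*}_{\xi}X-\tau^{*}(X)\xi$. The difference tensor is $K(X,Y)=\frac12(\nabla_XY-\nabla^{*}_XY)$. A distribution $\mathcal D$ on $M$ is parallel with respect to a connection $D$ if $D_XY\in\Gamma(\mathcal D)$ for all $X\in\Gamma(TM)$, $Y\in\Gamma(\mathcal D)$. *)

(* Defs.v *)
From HB Require Import structures.
From mathcomp Require Import all_boot all_order all_algebra.
From mathcomp Require Import all_classical all_reals all_analysis.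
Set Implicit Arguments.
Unset Strict Implicit.
Unset Printing Implicit Defensive.
Import Order.TTheory GRing.Theory Num.Theory.
Import numFieldNormedType.Exports.
Local Open Scope classical_set_scope.
Local Open Scope ring_scope.

(* C^oo on an open set A: every iterated directional derivative is
   differentiable at every point of A. *)
Definition smooth_on (R : realType) (n : nat) (V : normedModType R)
    (A : set 'rV[R]_n) (h : 'rV[R]_n -> V) : Prop :=
  forall (vs : seq 'rV[R]_n) (x : 'rV[R]_n), A x ->
    differentiable (foldr (fun v k => 'D_v k) h vs) x.

(* A smooth n-manifold, given by an atlas.  The distinguished chart [pref p]
   around p is only used to model T_pM as 'rV_n: a row vector u : 'rV_n stands
   for the tangent vector at p whose components in the chart [pref p] are u.
   The functions [chart i] and [inv i] are total; their values outside of
   [dom i] and of [chart i @` dom i] are irrelevant. *)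
Record manifold (R : realType) (n : nat) := Manifold {
  carrier :> topologicalType;
  atlas : Type;
  dom : atlas -> set carrier;
  chart : atlas -> carrier -> 'rV[R]_n;
  inv : atlas -> 'rV[R]_n -> carrier;
  pref : carrier -> atlas;
  manifold_hausdorff : hausdorff_space carrier;
  manifold_second_countable : @second_countable carrier;
  dom_open : forall i, open (dom i);
  codom_open : forall i, open (chart i @` dom i);
  chart_continuous : forall i, {within dom i, continuous (chart i)};
  inv_continuous : forall i, {within chart i @` dom i, continuous (inv i)};
  chartK : forall i p, dom i p -> inv i (chart i p) = p;
  transition_smooth : forall i j,
    smooth_on (chart i @` (dom i `&` dom j)) (chart j \o inv i);
  pref_dom : forall p, dom (pref p) p }.

Definition vfield (R : realType) (n : nat) (M : manifold R n) : Type :=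
  M -> 'rV[R]_n.

(* Row i of [frame c p] is the coordinate vector d/dx_i of the chart c at p;
   u *m [comps c p] is the row of components of u : T_pM in the chart c. *)
Definition frame (R : realType) (n : nat) (M : manifold R n) (c : atlas M)
    (p : M) : 'M[R]_n :=
  jacobian (chart (pref p) \o inv c) (chart c p).

Definition comps (R : realType) (n : nat) (M : manifold R n) (c : atlas M)
    (p : M) : 'M[R]_n :=
  jacobian (chart c \o inv (pref p)) (chart (pref p) p).

(* The local vector field, defined on [dom c], with constant components v. *)
Definition coord_field (R : realType) (n : nat) (M : manifold R n)
    (c : atlas M) (v : 'rV[R]_n) : vfield M :=
  fun p => v *m frame c p.

Definition smooth_fun (R : realType) (n : nat) (M : manifold R n)
    (V : normedModType R) (U : set M) (h : M -> V) : Prop :=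
  forall i : atlas M, smooth_on (chart i @` (U `&` dom i)) (h \o inv i).

Definition smooth_field (R : realType) (n : nat) (M : manifold R n)
    (U : set M) (X : vfield M) : Prop :=
  forall i : atlas M, smooth_on (chart i @` (U `&` dom i))
    ((fun p => X p *m comps i p) \o inv i).

Definition dirder (R : realType) (n : nat) (M : manifold R n)
    (V : normedModType R) (h : M -> V) (p : M) (u : 'rV[R]_n) : V :=
  'd (h \o inv (pref p)) (chart (pref p) p) u.

Definition der (R : realType) (n : nat) (M : manifold R n) (X : vfield M)
    (h : M -> R^o) : M -> R^o :=
  fun p => dirder h p (X p).

(* Affine connections, acting on local vector fields: a vector field on an open
   set U is represented by any total function that is smooth on U, and only the
   values on U of the covariant derivative are meaningful. *)
Record affine_connection (R : realType) (n : nat) (M : manifold R n)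
    (D : vfield M -> vfield M -> vfield M) : Prop := {
  conn_smooth : forall (U : set M) (X Y : vfield M), open U ->
    smooth_field U X -> smooth_field U Y -> smooth_field U (D X Y);
  conn_local : forall (U : set M) (X X' Y Y' : vfield M), open U ->
    smooth_field U X -> smooth_field U X' ->
    smooth_field U Y -> smooth_field U Y' ->
    {in U, X =1 X'} -> {in U, Y =1 Y'} -> {in U, D X Y =1 D X' Y'};
  conn_linear : forall (U : set M) (h : M -> R^o) (X X' Y : vfield M), open U ->
    smooth_fun U h -> smooth_field U X -> smooth_field U X' ->
    smooth_field U Y -> forall p, U p ->
    D (fun q => h q *: X q + X' q) Y p = h p *: D X Y p + D X' Y p;
  conn_leibniz : forall (U : set M) (h : M -> R^o) (X Y Y' : vfield M), open U ->
    smooth_fun U h -> smooth_field U X -> smooth_field U Y ->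
    smooth_field U Y' -> forall p, U p ->
    D X (fun q => h q *: Y q + Y' q) p =
      der X h p *: Y p + h p *: D X Y p + D X Y' p }.

(* D_X Y - D_Y X = [X, Y], both sides acting on functions. *)
Definition torsion_free (R : realType) (n : nat) (M : manifold R n)
    (D : vfield M -> vfield M -> vfield M) : Prop :=
  forall (U : set M) (X Y : vfield M) (h : M -> R^o), open U ->
    smooth_field U X -> smooth_field U Y -> smooth_fun U h -> forall p, U p ->
    der (D X Y) h p - der (D Y X) h p = der X (der Y h) p - der Y (der X h) p.

(* g p is the Gram matrix of the metric on T_pM = 'rV_n. *)
Definition tensor2 (R : realType) (n : nat) (M : manifold R n) : Type :=
  M -> 'M[R]_n.

Definition ip (R : realType) (n : nat) (A : 'M[R]_n) (u v : 'rV[R]_n) : R :=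
  (u *m A *m v^T) 0 0.

Definition metric (R : realType) (n : nat) (M : manifold R n) (g : tensor2 M)
    (X Y : vfield M) : M -> R^o :=
  fun p => ip (g p) (X p) (Y p).

Definition negative_on (R : realType) (n : nat) (A V : 'M[R]_n) : Prop :=
  forall u : 'rV[R]_n, (u <= V)%MS -> u != 0 -> ip A u u < 0.

Definition has_index (R : realType) (n : nat) (A : 'M[R]_n) (q : nat) : Prop :=
  (exists2 V : 'M[R]_n, \rank V = q & negative_on A V) /\
  (forall V : 'M[R]_n, negative_on A V -> (\rank V <= q)%N).

Record semi_riemannian (R : realType) (n : nat) (M : manifold R n)
    (g : tensor2 M) : Prop := {
  metric_sym : forall p, (g p)^T = g p;
  metric_nondegenerate : forall p, g p \in unitmx;
  metric_index : exists q, forall p, has_index (g p) q;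
  metric_smooth : forall i : atlas M, smooth_on (chart i @` dom i)
    ((fun p => frame i p *m g p *m (frame i p)^T) \o inv i) }.

(* (D_X g)(Y, Z) *)
Definition cov_metric (R : realType) (n : nat) (M : manifold R n)
    (g : tensor2 M) (D : vfield M -> vfield M -> vfield M)
    (X Y Z : vfield M) : M -> R :=
  fun p => der X (metric g Y Z) p - metric g (D X Y) Z p - metric g Y (D X Z) p.

Record indefinite_statistical (R : realType) (n : nat) (M : manifold R n)
    (g : tensor2 M) (D Ds : vfield M -> vfield M -> vfield M) : Prop := {
  stat_metric : semi_riemannian g;
  stat_connection : affine_connection D;
  stat_torsion_free : torsion_free D;
  stat_codazzi : forall (U : set M) (X Y Z : vfield M), open U ->
    smooth_field U X -> smooth_field U Y -> smooth_field U Z ->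
    forall p, U p -> cov_metric g D X Y Z p = cov_metric g D Y X Z p;
  stat_dual_connection : affine_connection Ds;
  stat_dual : forall (U : set M) (X Y Z : vfield M), open U ->
    smooth_field U X -> smooth_field U Y -> smooth_field U Z ->
    forall p, U p ->
    der X (metric g Y Z) p = metric g (D X Y) Z p + metric g Y (Ds X Z) p }.

(* The differential T_pM -> T_(f p)M', u |-> u *m [tmap f p]. *)
Definition tmap (R : realType) (n m : nat) (M : manifold R n)
    (M' : manifold R m) (f : M -> M') (p : M) : 'M[R]_(n, m) :=
  jacobian (chart (pref (f p)) \o f \o inv (pref p)) (chart (pref p) p).

Record smooth_immersion (R : realType) (n m : nat) (M : manifold R n)
    (M' : manifold R m) (f : M -> M') : Prop := {
  immersion_continuous : continuous f;
  immersion_smooth : forall (i : atlas M) (j : atlas M'),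
    smooth_on (chart i @` (dom i `&` f @^-1` dom j)) (chart j \o f \o inv i);
  immersion_injective : forall p, row_free (tmap f p) }.

(* Vector fields along f: V p is a tangent vector of M' at f p. *)
Definition afield (R : realType) (n m : nat) (M : manifold R n)
    (M' : manifold R m) (f : M -> M') : Type := M -> 'rV[R]_m.

Definition smooth_along (R : realType) (n m : nat) (M : manifold R n)
    (M' : manifold R m) (f : M -> M') (U : set M) (V : afield f) : Prop :=
  forall (i : atlas M) (j : atlas M'),
    smooth_on (chart i @` (U `&` dom i `&` f @^-1` dom j))
      ((fun p => V p *m comps j (f p)) \o inv i).

Definition push (R : realType) (n m : nat) (M : manifold R n)
    (M' : manifold R m) (f : M -> M') (X : vfield M) : afield f :=
  fun p => X p *m tmap f p.

(* Covariant derivative D_X V of a field V = V^k d/dx_k along f.  In the chart c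
   around f p it is
     X(V^k) d/dx_k + (df X)^i V^k D_(d/dx_i) d/dx_k,
   whose second term is D applied to the two fields with constant components
   (df X)(p) and V(p) in c. *)
Definition cov_along (R : realType) (n m : nat) (M : manifold R n)
    (M' : manifold R m) (D : vfield M' -> vfield M' -> vfield M')
    (f : M -> M') (X : vfield M) (V : afield f) : afield f :=
  fun p => let c := pref (f p) in
    dirder (fun q => V q *m comps c (f q)) p (X p) +
    D (coord_field c (push f X p)) (coord_field c (V p)) (f p).

Definition induced_metric (R : realType) (n m : nat) (M : manifold R n)
    (M' : manifold R m) (g : tensor2 M') (f : M -> M') : tensor2 M :=
  fun p => tmap f p *m g (f p) *m (tmap f p)^T.

(* The codimension is one since dim M = n and dim M' = n.+1. *)
Definition lightlike_hypersurface (R : realType) (n : nat) (M : manifold R n)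
    (M' : manifold R n.+1) (g : tensor2 M') (f : M -> M') : Prop :=
  smooth_immersion f /\ forall p, induced_metric g f p \notin unitmx.

(* Fields of subspaces of the tangent spaces, as row spaces of matrices. *)
Definition subspaces (R : realType) (n : nat) (M : manifold R n) : Type :=
  M -> 'M[R]_n.

Definition smooth_distribution (R : realType) (n : nat) (M : manifold R n) (r : nat)
    (E : subspaces M) : Prop :=
  forall p, exists (U : set M) (e : 'I_r -> vfield M),
    [/\ open U, U p, forall k, smooth_field U (e k) &
      forall q, U q -> let F := \matrix_k e k q in
        row_free F /\ (F == E q)%MS].

(* The vectors u in T_pM with g(u, v) = 0 for all v in T_pM. *)
Definition Rad (R : realType) (n m : nat) (M : manifold R n)
    (M' : manifold R m) (g : tensor2 M') (f : M -> M') : subspaces M :=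
  fun p => kermx (induced_metric g f p).

Record screen_distribution (R : realType) (n m : nat) (M : manifold R n)
    (M' : manifold R m) (g : tensor2 M') (f : M -> M') (S : subspaces M)
    : Prop := {
  screen_distr : smooth_distribution n.-1 S;
  screen_nondegenerate : forall p (u : 'rV[R]_n), (u <= S p)%MS ->
    (forall v : 'rV[R]_n, (v <= S p)%MS -> ip (induced_metric g f p) u v = 0) ->
    u = 0;
  screen_complement_cap : forall p, (S p :&: Rad g f p)%MS = 0;
  screen_complement_sum : forall p, (S p + Rad g f p == 1%:M)%MS }.

Definition section_of (R : realType) (n : nat) (M : manifold R n) (W : set M)
    (E : subspaces M) (X : vfield M) : Prop :=
  smooth_field W X /\ forall p, W p -> (X p <= E p)%MS.

Definition parallel (R : realType) (n : nat) (M : manifold R n) (W : set M)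
    (D : vfield M -> vfield M -> vfield M) (E : subspaces M) : Prop :=
  forall X Y : vfield M, smooth_field W X -> section_of W E Y ->
    section_of W E (D X Y).

Record lightlike_transversal (R : realType) (n m : nat) (M : manifold R n)
    (M' : manifold R m) (g : tensor2 M') (f : M -> M') (S : subspaces M)
    (W : set M) (xi : vfield M) (N : afield f) : Prop := {
  transversal_smooth : smooth_along W N;
  transversal_null : forall p, W p -> ip (g (f p)) (N p) (N p) = 0;
  transversal_xi : forall p, W p -> ip (g (f p)) (N p) (push f xi p) = 1;
  transversal_screen : forall p (u : 'rV[R]_n), W p -> (u <= S p)%MS ->
    ip (g (f p)) (N p) (u *m tmap f p) = 0 }.

(* D is the ambient connection, nabla the induced one. *)
Definition gauss_formula (R : realType) (n m : nat) (M : manifold R n)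
    (M' : manifold R m) (f : M -> M')
    (D : vfield M' -> vfield M' -> vfield M') (W : set M) (N : afield f)
    (nabla : vfield M -> vfield M -> vfield M)
    (B : vfield M -> vfield M -> M -> R) : Prop :=
  forall X Y : vfield M, smooth_field W X -> smooth_field W Y ->
    forall p, W p ->
    cov_along D X (push f Y) p = push f (nabla X Y) p + B X Y p *: N p.

(* nabla_X xi = - A X - tau(X) xi with A screen-valued. *)
Definition xi_decomposition (R : realType) (n : nat) (M : manifold R n)
    (W : set M) (S : subspaces M) (xi : vfield M)
    (nabla : vfield M -> vfield M -> vfield M)
    (A : vfield M -> vfield M) (tau : vfield M -> M -> R) : Prop :=
  forall X : vfield M, smooth_field W X -> forall p, W p ->
    (A X p <= S p)%MS /\ nabla X xi p = - A X p - tau X p *: xi p.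

Definition screen_proj (R : realType) (n m : nat) (M : manifold R n)
    (M' : manifold R m) (g : tensor2 M') (f : M -> M') (S : subspaces M)
    (X : vfield M) : vfield M :=
  fun p => X p *m proj_mx (S p) (Rad g f p).

Definition eta_form (R : realType) (n m : nat) (M : manifold R n)
    (M' : manifold R m) (g : tensor2 M') (f : M -> M') (N : afield f)
    (X : vfield M) : M -> R :=
  fun p => ip (g (f p)) (push f X p) (N p).

Definition difference_tensor (R : realType) (n : nat) (M : manifold R n)
    (nabla nablas : vfield M -> vfield M -> vfield M)
    (X Y : vfield M) : vfield M :=
  fun p => 2^-1 *: (nabla X Y p - nablas X Y p).

(* Main.v *)
Require Import Defs.
From HB Require Import structures.
From mathcomp Require Import all_boot all_order all_algebra.
From mathcomp Require Import all_classical all_reals all_analysis.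
Import Order.TTheory GRing.Theory Num.Theory.
Import numFieldNormedType.Exports.
Local Open Scope classical_set_scope.
Local Open Scope ring_scope.

(* The tensor T = D - D* of the ambient connections satisfies
   (D_X g)(Y, Z) = - g(Y, T(X, Z)) by duality.  The Codazzi condition and the
   symmetry of g make this form totally symmetric, so T is bilinear and symmetric.
   Subtracting the two Gauss formulas shows that K is half the tangential part of
   T, hence it is pointwise, bilinear and symmetric too.  When both
   distributions are parallel, K(W, xi) lies in Rad(TM) and K(xi, W) in S(TM), so
   both vanish; the rest follows by expanding along X = PX + eta(X) xi. *)

Set Implicit Arguments.
Unset Strict Implicit.

Local Notation inv := Defs.inv.

(** * Differentiability depends only on values near the point *)

Section LocalEquality.
Context (R : realType) (U V : normedModType R).
Implicit Types (h k : U -> V) (x : U).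

(** The first-order expansion of [h] at [x] only involves values near [x], so it is also one of [k];
    uniqueness of the differential then identifies it as ['d k x]. *)
Lemma near_eq_diff h k x : (\near x, h x = k x) ->
  differentiable h x -> differentiable k x.
Proof.
move=> hk /diff_locallyP [ch dh].
have dk : k \o shift x = cst (k x) + 'd h x +o_ 0 id.
  apply/eqaddoP => e e0; move/eqaddoP: dh => /(_ e e0).
  have : \forall y \near 0, h (y + x) = k (y + x).
    by rewrite (near_shift x 0); apply: filterS hk => y; rewrite /= sub0r subrK.
  have -> : k x = h x by rewrite (nbhs_singleton hk).
  by apply: filterS2 => y hky; rewrite !fctE /= hky.
by apply/diff_locallyP; rewrite (diff_unique ch dk).
Qed.

End LocalEquality.

(** * Locality of smoothness, and reduction to matrix entries *)

Section SmoothOn.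
Context (R : realType) (n : nat).
Implicit Types (A : set 'rV[R]_n) (vs : seq 'rV[R]_n).

Local Notation iter_derive vs h := (foldr (fun v k => 'D_v k) h vs).

Lemma open_near_eq (V : normedModType R) A (h k : 'rV[R]_n -> V) x :
  open A -> (forall x, A x -> h x = k x) -> A x -> \near x, h x = k x.
Proof. by move=> oA hk Ax; apply: filterS hk _; exact: open_nbhs_nbhs. Qed.

(** Openness of [A] turns equality on [A] into equality near each of its points, which is what every
    further derivative requires. *)
Lemma eq_iter_derive (V : normedModType R) A (h k : 'rV[R]_n -> V) vs :
  open A -> (forall x, A x -> h x = k x) ->
  forall x, A x -> iter_derive vs h x = iter_derive vs k x.
Proof.
move=> oA hk; elim: vs => //= v vs IH x Ax.
by apply: near_eq_derive; apply: open_near_eq IH Ax.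
Qed.

Lemma eq_smooth_on (V : normedModType R) A (h k : 'rV[R]_n -> V) :
  open A -> (forall x, A x -> h x = k x) -> smooth_on A h -> smooth_on A k.
Proof.
move=> oA hk sh vs x Ax; apply: near_eq_diff (sh vs x Ax).
by apply: open_near_eq Ax => //; exact: eq_iter_derive.
Qed.

Lemma smooth_on_diff (V : normedModType R) A (h : 'rV[R]_n -> V) x :
  smooth_on A h -> A x -> differentiable h x.
Proof. by move=> sh Ax; exact: sh [::] x Ax. Qed.

Lemma smooth_on_derive (V : normedModType R) A (h : 'rV[R]_n -> V) v :
  smooth_on A h -> smooth_on A ('D_v h).
Proof. by move=> sh vs x Ax; move: (sh (rcons vs v) x Ax); rewrite foldr_rcons. Qed.

Lemma smooth_on_sub (V : normedModType R) A B (h : 'rV[R]_n -> V) :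
  A `<=` B -> smooth_on B h -> smooth_on A h.
Proof. by move=> AB sh vs x /AB; exact: sh. Qed.

(** Permits a choice of chart around each point separately. *)
Lemma smooth_on_nbhs (V : normedModType R) A (h : 'rV[R]_n -> V) :
  (forall x, A x -> exists2 B, B x & smooth_on B h) -> smooth_on A h.
Proof. by move=> loc vs x /loc [B Bx sh]; exact: sh. Qed.

Lemma smooth_on_cst (V : normedModType R) A (a : V) : smooth_on A (cst a).
Proof.
move=> vs x _; suff [b ->] : exists b, iter_derive vs (cst a) = cst b.
  exact: differentiable_cst.
elim: vs => [|v vs [b IH]]; first by exists a.
by exists 0; rewrite /= IH; apply/funext => y; rewrite derive_cst.
Qed.

Lemma coord_sum_delta (p q : nat) (h : 'rV[R]_n -> 'M[R]_(p, q)) :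
  h = \sum_i \sum_j (fun x => h x i j *: delta_mx i j).
Proof.
apply/funext => x; rewrite [LHS]matrix_sum_delta fct_sumE.
by apply: eq_bigr => i _; rewrite fct_sumE.
Qed.

Lemma differentiable_mx (p q : nat) (h : 'rV[R]_n -> 'M[R]_(p, q)) x :
  (forall i j, differentiable (fun y => h y i j : R^o) x) -> differentiable h x.
Proof.
move=> dh; rewrite (coord_sum_delta h); apply: differentiable_sum => i.
by apply: differentiable_sum => j; apply: differentiableZl.
Qed.

Lemma differentiable_entry (p q : nat) (h : 'rV[R]_n -> 'M[R]_(p, q)) x i j :
  differentiable h x -> differentiable (fun y => h y i j : R^o) x.
Proof.
move=> dh; apply: (differentiable_comp (g := fun N : 'M[R]_(p, q) => N i j : R^o)) => //.
exact: differentiable_coord.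
Qed.

Lemma derive_entry (p q : nat) (h : 'rV[R]_n -> 'M[R]_(p, q)) x v i j :
  differentiable h x -> 'D_v h x i j = 'D_v (fun y => h y i j : R^o) x.
Proof. by move=> dh; rewrite derive_mx ?mxE //; exact: diff_derivable. Qed.

Lemma smooth_on_entry (p q : nat) A (h : 'rV[R]_n -> 'M[R]_(p, q)) i j :
  open A -> smooth_on A h -> smooth_on A (fun x => h x i j : R^o).
Proof.
move=> oA sh vs; have E : forall x, A x ->
    iter_derive vs (fun x => h x i j : R^o) x = (iter_derive vs h x i j : R^o).
  elim: vs => //= v vs IH x Ax; rewrite derive_entry; last exact: sh.
  by apply: near_eq_derive; apply: open_near_eq Ax.
move=> x Ax; apply: (@near_eq_diff R _ _ (fun x => iter_derive vs h x i j : R^o)).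
  by apply: open_near_eq Ax => // y Ay; rewrite E.
exact: differentiable_entry (sh vs x Ax).
Qed.

(** Differentiation commutes with taking entries once the matrix-valued iterated derivative is
    differentiable; the induction recovers this from the entries at each stage. *)
Lemma smooth_on_mx (p q : nat) A (h : 'rV[R]_n -> 'M[R]_(p, q)) :
  open A -> (forall i j, smooth_on A (fun x => h x i j : R^o)) -> smooth_on A h.
Proof.
move=> oA sh vs.
have E : forall x, A x -> forall i j,
    iter_derive vs (fun x => h x i j : R^o) x = (iter_derive vs h x i j : R^o).
  elim: vs => //= v vs IH x Ax i j; rewrite derive_entry.
    by apply: near_eq_derive; apply: open_near_eq Ax => // y Ay; exact: IH.
  apply: differentiable_mx => k l; apply: near_eq_diff (sh k l vs x Ax).
  by apply: open_near_eq Ax => // y Ay; exact: IH.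
move=> x Ax; apply: differentiable_mx => i j.
by apply: near_eq_diff (sh i j vs x Ax); apply: open_near_eq Ax => // y Ay; exact: E.
Qed.

End SmoothOn.

(** * Closure of smooth functions under composition, sums and products *)

Section SmoothAlgebra.
Context (R : realType) (n : nat).
Implicit Types (A : set 'rV[R]_n).

(* The chain rule and the Leibniz rule express the derivatives of an element of
   this family by elements of the family, so that all of them are smooth. *)
Inductive smooth_expr A : ('rV[R]_n -> R^o) -> Prop :=
| smooth_expr_comp m (B : set 'rV[R]_m) (phi : 'rV[R]_n -> 'rV[R]_m)
    (h : 'rV[R]_m -> R^o) :
    smooth_on A phi -> smooth_on B h -> (forall x, A x -> B (phi x)) ->
    smooth_expr A (h \o phi)
| smooth_expr_base h : smooth_on A h -> smooth_expr A h
| smooth_expr_add h k : smooth_expr A h -> smooth_expr A k -> smooth_expr A (h + k)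
| smooth_expr_mul h k : smooth_expr A h -> smooth_expr A k ->
    smooth_expr A (fun x => h x * k x).

Lemma smooth_expr_sum A m (F : 'I_m -> 'rV[R]_n -> R^o) :
  (forall i, smooth_expr A (F i)) -> smooth_expr A (\sum_i F i).
Proof.
move=> sF; apply: big_ind => // [|h k]; last exact: smooth_expr_add.
exact/smooth_expr_base/smooth_on_cst.
Qed.

Lemma smooth_expr_diff A h : open A -> smooth_expr A h ->
  forall x, A x -> differentiable h x.
Proof.
move=> oA; elim=> {h} [m B phi h sphi sh AB|h sh|h k _ dh _ dk|h k _ dh _ dk] x Ax.
- by apply: differentiable_comp; [exact: smooth_on_diff Ax |
    exact: smooth_on_diff (AB _ Ax)].
- exact: smooth_on_diff Ax.
- by apply: differentiableD; [exact: dh | exact: dk].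
- by apply: (@differentiableM R _ h k); [exact: dh | exact: dk].
Qed.

Lemma smooth_expr_derive A h v : open A -> smooth_expr A h ->
  exists2 k, smooth_expr A k & forall x, A x -> 'D_v h x = k x.
Proof.
move=> oA; elim=> {h} [m B phi h sphi sh AB|h sh|h k eh [h' eh' Eh] ek [k' ek' Ek]
    |h k eh [h' eh' Eh] ek [k' ek' Ek]].
(* Chain rule in coordinates: the factors are an entry of a derivative of [phi] and a partial
   derivative of [h] composed with [phi], so the sum stays in the family. *)
- exists (\sum_k (fun x => ('D_v phi x 0 k : R^o) * ('D_(delta_mx 0 k) h \o phi) x)).
    apply: smooth_expr_sum => k; apply: smooth_expr_mul.
      by apply/smooth_expr_base/smooth_on_entry/smooth_on_derive.
    by apply: (@smooth_expr_comp A m B phi) => //; exact: smooth_on_derive.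
  move=> x Ax; have dphi := smooth_on_diff sphi Ax.
  have dh := smooth_on_diff sh (AB _ Ax).
  rewrite deriveE; last exact: differentiable_comp.
  rewrite diff_comp //= fct_sumE (deriveE v dphi).
  rewrite [in LHS](matrix_sum_delta ('d phi x v)) big_ord1 linear_sum.
  by apply: eq_bigr => k _ /=; rewrite linearZ deriveE.
- by exists ('D_v h) => //; exact/smooth_expr_base/smooth_on_derive.
- exists (h' + k'); first exact: smooth_expr_add.
  move=> x Ax; rewrite deriveD ?Eh ?Ek //; apply: diff_derivable;
    exact: smooth_expr_diff Ax.
- exists ((fun x => h x * k' x) + (fun x => k x * h' x)).
    by apply: smooth_expr_add; exact: smooth_expr_mul.
  move=> x Ax; rewrite (@deriveM R _ h k) ?Eh ?Ek //; apply: diff_derivable;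
    exact: smooth_expr_diff Ax.
Qed.

Lemma smooth_on_expr A h : open A -> smooth_expr A h -> smooth_on A h.
Proof.
(* [foldr] differentiates along the last direction first; peeling it off replaces [h] by its
   derivative, which agrees on [A] with an element of the family. *)
move=> oA eh vs; elim/last_ind: vs h eh => [|vs v IH] h eh x Ax.
  exact: smooth_expr_diff Ax.
rewrite foldr_rcons; have [k ek Ek] := smooth_expr_derive v oA eh.
apply: near_eq_diff (IH k ek x Ax); apply: open_near_eq Ax => // y Ay.
by apply: eq_iter_derive Ay => // z Az; rewrite Ek.
Qed.

Lemma smooth_on_mul A (h k : 'rV[R]_n -> R^o) : open A ->
  smooth_on A h -> smooth_on A k -> smooth_on A (fun x => h x * k x).
Proof.
move=> oA sh sk; apply/smooth_on_expr/smooth_expr_mul => //;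
  exact: smooth_expr_base.
Qed.

Lemma smooth_on_sum A m (F : 'I_m -> 'rV[R]_n -> R^o) : open A ->
  (forall i, smooth_on A (F i)) -> smooth_on A (fun x => \sum_i F i x).
Proof.
move=> oA sF; apply: (@eq_smooth_on _ _ _ _ (\sum_i F i)) => //.
  by move=> x _; rewrite fct_sumE.
by apply: smooth_on_expr => //; apply: smooth_expr_sum => i; exact: smooth_expr_base.
Qed.

Lemma smooth_on_comp A m (B : set 'rV[R]_m) p q (phi : 'rV[R]_n -> 'rV[R]_m)
    (h : 'rV[R]_m -> 'M[R]_(p, q)) :
  open A -> open B -> smooth_on A phi -> smooth_on B h ->
  (forall x, A x -> B (phi x)) -> smooth_on A (h \o phi).
Proof.
move=> oA oB sphi sh AB; apply: smooth_on_mx => // i j; apply: smooth_on_expr => //.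
apply: (@smooth_expr_comp A m B phi (fun y => h y i j)) => //.
exact: smooth_on_entry.
Qed.

Lemma smooth_on_add A p q (h k : 'rV[R]_n -> 'M[R]_(p, q)) : open A ->
  smooth_on A h -> smooth_on A k -> smooth_on A (fun x => h x + k x).
Proof.
move=> oA sh sk; apply: smooth_on_mx => // i j; apply: smooth_on_expr => //.
have -> : (fun x => (h x + k x) i j : R^o) =
    (fun x => h x i j : R^o) + (fun x => k x i j : R^o).
  by apply/funext => x; rewrite mxE.
by apply: smooth_expr_add; apply: smooth_expr_base; exact: smooth_on_entry.
Qed.

Lemma smooth_on_scale A p q (h : 'rV[R]_n -> R^o) (k : 'rV[R]_n -> 'M[R]_(p, q)) :
  open A -> smooth_on A h -> smooth_on A k -> smooth_on A (fun x => h x *: k x).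
Proof.
move=> oA sh sk; apply: smooth_on_mx => // i j.
have -> : (fun x => (h x *: k x) i j : R^o) = (fun x => h x * (k x i j : R^o)).
  by apply/funext => x; rewrite mxE.
by apply: smooth_on_mul => //; exact: smooth_on_entry.
Qed.

Lemma smooth_on_mulmx A p q r (h : 'rV[R]_n -> 'M[R]_(p, q))
    (k : 'rV[R]_n -> 'M[R]_(q, r)) :
  open A -> smooth_on A h -> smooth_on A k -> smooth_on A (fun x => h x *m k x).
Proof.
move=> oA sh sk; apply: smooth_on_mx => // i j.
have -> : (fun x => (h x *m k x) i j : R^o) =
    (fun x => \sum_l (h x i l : R^o) * (k x l j : R^o)).
  by apply/funext => x; rewrite mxE.
by apply: smooth_on_sum => // l; apply: smooth_on_mul => //; exact: smooth_on_entry.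
Qed.

Lemma smooth_on_trmx A p q (h : 'rV[R]_n -> 'M[R]_(p, q)) :
  open A -> smooth_on A h -> smooth_on A (fun x => (h x)^T).
Proof.
move=> oA sh; apply: smooth_on_mx => // i j.
have -> : (fun x => (h x)^T i j : R^o) = (fun x => h x j i : R^o).
  by apply/funext => x; rewrite mxE.
exact: smooth_on_entry.
Qed.

(** Row [i] of the Jacobian is the derivative along the [i]-th basis vector. *)
Lemma smooth_on_jacobian A m (h : 'rV[R]_n -> 'rV[R]_m) :
  open A -> smooth_on A h -> smooth_on A (jacobian h).
Proof.
move=> oA sh; apply: smooth_on_mx => // i j.
apply: (@eq_smooth_on _ _ _ A (fun x => 'D_(delta_mx 0 i) h x 0 j)) => //.
  by move=> x Ax; rewrite deriveEjacobian -?rowE ?mxE //; exact: smooth_on_diff Ax.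
exact/smooth_on_entry/smooth_on_derive.
Qed.

End SmoothAlgebra.

(** * Jacobians: locality and the chain rule *)

Section Jacobian.
Context (R : realType).

Lemma near_eq_jacobian n m (h k : 'rV[R]_n -> 'rV[R]_m) x :
  (\near x, h x = k x) -> differentiable h x -> jacobian h x = jacobian k x.
Proof.
move=> hk dh; have dk := near_eq_diff hk dh.
have E v : 'd h x v = 'd k x v.
  by rewrite -[LHS](deriveE v dh) -[RHS](deriveE v dk); exact: near_eq_derive.
apply/matrixP => i j; rewrite /jacobian [LHS]mxE [RHS]mxE.
exact: (congr1 (fun A : 'rV__ => A 0 j) (E _)).
Qed.

(** Tangent vectors are rows, so the Jacobian of the inner map stands on the left. *)
Lemma jacobian_comp n m l (phi : 'rV[R]_n -> 'rV[R]_m) (psi : 'rV[R]_m -> 'rV[R]_l) x :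
  differentiable phi x -> differentiable psi (phi x) ->
  jacobian (psi \o phi) x = jacobian phi x *m jacobian psi (phi x).
Proof.
move=> dphi dpsi; apply/row_matrixP => i; rewrite !rowE mulmxA !mul_rV_lin1.
by rewrite diff_comp.
Qed.

Lemma jacobian_id n (x : 'rV[R]_n) : jacobian id x = 1%:M.
Proof.
by apply/row_matrixP => i; rewrite rowE mul_rV_lin1 diff_val row1.
Qed.

End Jacobian.

(** * Topology of charts *)

Section Charts.
Context (R : realType) (n : nat) (M : manifold R n).
Implicit Types (U : set M) (i j : atlas M) (p q : M).

Lemma inv_continuous_at i p : dom i p -> {for chart i p, continuous (inv i)}.
Proof.
move=> ip; have := @Defs.inv_continuous _ _ M i.
by rewrite continuous_open_subspace; [apply; rewrite inE; exists p | exact: codom_open].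
Qed.

Lemma chart_near i p (V : set M) : dom i p -> nbhs p V ->
  \forall x \near chart i p, V (inv i x).
Proof.
by move=> ip Vp; have /(_ V) := inv_continuous_at ip; rewrite chartK //; apply.
Qed.

(** Rewrites the image as a preimage under [inv i], whose continuity then shows it to be open. *)
Lemma chart_imageE i U :
  chart i @` (U `&` dom i) = (chart i @` dom i) `&` inv i @^-1` U.
Proof.
apply/seteqP; split=> [_ [p [Up ip] <-]|x [[p ip <-]]] /=; rewrite chartK //;
  last by exists p.
by split; first by exists p.
Qed.

Lemma open_chart_image i U : open U -> open (chart i @` (U `&` dom i)).
Proof.
move=> oU; rewrite chart_imageE; have oC := @codom_open _ _ M i.
have := @Defs.inv_continuous _ _ M i.
by rewrite continuous_open_subspace // => /(continuous_inP _ oC); exact.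
Qed.

Lemma jacobian_chart_inv i p : dom i p -> jacobian (chart i \o inv i) (chart i p) = 1%:M.
Proof.
move=> ip; rewrite -[RHS](jacobian_id (chart i p)); apply/esym/near_eq_jacobian => //.
have : open_nbhs (chart i p) (chart i @` dom i) by split; [exact: codom_open | exists p].
by move/open_nbhs_nbhs; apply: filterS => _ [q iq <-]; rewrite /= chartK.
Qed.

Lemma frame_pref p : frame (pref p) p = 1%:M.
Proof. exact/jacobian_chart_inv/pref_dom. Qed.

End Charts.

(** * Smooth maps between manifolds and changes of frame *)

Section SmoothMaps.
Context (R : realType).

(** Immersions without injectivity of the differential. The identity qualifies, so one chain rule
    serves both chart transitions and tangent maps. *)
Definition smooth_map n m (M : manifold R n) (M' : manifold R m) (f : M -> M') : Prop :=
  continuous f /\ forall (i : atlas M) (j : atlas M'),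
    smooth_on (chart i @` (dom i `&` f @^-1` dom j)) (chart j \o f \o inv i).

Lemma smooth_map_id n (M : manifold R n) : smooth_map (@idfun M).
Proof. by split=> [p|i j]; [exact: cvg_id | exact: transition_smooth]. Qed.

Lemma smooth_map_diff n m (M : manifold R n) (M' : manifold R m) (f : M -> M') i j p :
  smooth_map f -> dom i p -> dom j (f p) ->
  differentiable (chart j \o f \o inv i) (chart i p).
Proof. by move=> [_ sf] ip jfp; apply: smooth_on_diff (sf i j) _; exists p. Qed.

(** By continuity [f] maps a neighbourhood of [p] into [dom j], where the intermediate [inv j] and
    [chart j] cancel; the rest is the chain rule. *)
Lemma jacobian_map_comp n m l (M : manifold R n) (M' : manifold R m)
    (M'' : manifold R l) (f : M -> M') (g : M' -> M'') i j k p :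
  smooth_map f -> smooth_map g -> dom i p -> dom j (f p) -> dom k (g (f p)) ->
  jacobian (chart j \o f \o inv i) (chart i p) *m
    jacobian (chart k \o g \o inv j) (chart j (f p)) =
  jacobian (chart k \o (g \o f) \o inv i) (chart i p).
Proof.
move=> sf sg ip jfp kgfp; pose phi := chart j \o f \o inv i.
pose psi := chart k \o g \o inv j.
have E : phi (chart i p) = chart j (f p) by rewrite /phi /= chartK.
have dphi : differentiable phi (chart i p) by exact: smooth_map_diff.
have dpsi : differentiable psi (phi (chart i p)) by rewrite E; exact: smooth_map_diff.
have := jacobian_comp dphi dpsi; rewrite E => <-.
have dcomp := differentiable_comp dphi dpsi; apply: near_eq_jacobian dcomp.
have : nbhs p (f @^-1` dom j).
  by apply: sf.1; apply: open_nbhs_nbhs; split=> //; exact: dom_open.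
move/(chart_near ip); apply: filterS => x /= jfx.
by rewrite /psi /phi /= chartK.
Qed.

Section Transitions.
Context (n : nat) (M : manifold R n).
Implicit Types (i j c : atlas M) (p : M).

Lemma frame_comps c i p : dom c p -> dom i p ->
  frame c p *m comps i p = jacobian (chart i \o inv c) (chart c p).
Proof.
move=> cp ip; have sid := smooth_map_id M.
exact: (jacobian_map_comp sid sid cp (pref_dom p) ip).
Qed.

Lemma frameK c p : dom c p -> frame c p *m comps c p = 1%:M.
Proof. by move=> cp; rewrite frame_comps // jacobian_chart_inv. Qed.

Lemma compsK c p : dom c p -> comps c p *m frame c p = 1%:M.
Proof. by move=> cp; apply: mulmx1C; exact: frameK. Qed.

End Transitions.

(** Two chain rules eliminate the distinguished charts at [p] and [f p], which may vary without any
    regularity; what remains is smooth in [p]. *)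
Lemma frame_tmap_comps n m (M : manifold R n) (M' : manifold R m) (f : M -> M') i j p :
  smooth_map f -> dom i p -> dom j (f p) ->
  frame i p *m tmap f p *m comps j (f p) = jacobian (chart j \o f \o inv i) (chart i p).
Proof.
move=> sf ip jfp.
have E := jacobian_map_comp (smooth_map_id M) sf ip (pref_dom p) (pref_dom (f p)).
rewrite [frame i p *m _]E.
exact: (jacobian_map_comp sf (smooth_map_id M') ip (pref_dom (f p)) jfp).
Qed.

End SmoothMaps.

(** * Operations on smooth vector fields *)

Section SmoothFields.
Context (R : realType) (n : nat) (M : manifold R n).
Implicit Types (U : set M) (X Y : vfield M).

Lemma smooth_fieldD U X Y : open U -> smooth_field U X -> smooth_field U Y ->
  smooth_field U (fun p => X p + Y p).
Proof.
move=> oU sX sY i; have oA := open_chart_image (i := i) oU.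
apply: (eq_smooth_on oA _ (smooth_on_add oA (sX i) (sY i))).
by move=> x _ /=; rewrite mulmxDl.
Qed.

Lemma smooth_fieldZ U (h : M -> R^o) X : open U -> smooth_fun U h -> smooth_field U X ->
  smooth_field U (fun p => h p *: X p).
Proof.
move=> oU sh sX i; have oA := open_chart_image (i := i) oU.
apply: (eq_smooth_on oA _ (smooth_on_scale oA (sh i) (sX i))).
by move=> x _ /=; rewrite scalemxAl.
Qed.

Lemma smooth_fun_cst U (a : R) : @smooth_fun _ _ M R^o U (cst a).
Proof. move=> i; exact: smooth_on_cst. Qed.

(** In a chart [i] the components are [v] times the Jacobian of the transition from [c] to [i]. *)
Lemma smooth_coord_field (c : atlas M) (v : 'rV[R]_n) :
  smooth_field (dom c) (coord_field c v).
Proof.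
move=> i; have oA : open (chart i @` (dom c `&` dom i)).
  exact/open_chart_image/dom_open.
have oB : open (chart c @` (dom c `&` dom i)).
  by rewrite setIC; apply/open_chart_image/dom_open.
have sJ := smooth_on_jacobian oB (transition_smooth (i := c) (j := i)).
have sphi : smooth_on (chart i @` (dom c `&` dom i)) (chart c \o inv i).
  by rewrite setIC; exact: transition_smooth.
have sJphi := smooth_on_comp oA oB sphi sJ.
apply: (eq_smooth_on oA _ (smooth_on_mulmx oA (smooth_on_cst v) (sJphi _))).
  move=> _ [p [cp ip] <-] /=; rewrite (chartK ip) /coord_field.
  by rewrite -mulmxA (frame_comps cp ip).
by move=> _ [p [cp ip] <-] /=; rewrite chartK //; exists p.
Qed.

End SmoothFields.

(** * Linear algebra of Gram matrices *)

Section BilinearForms.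
Context (R : realType) (n : nat) (A : 'M[R]_n).
Implicit Types (u v w : 'rV[R]_n) (a : R).

Lemma ipDl u v w : ip A (u + v) w = ip A u w + ip A v w.
Proof. by rewrite /ip !mulmxDl mxE. Qed.

Lemma ipZl a u w : ip A (a *: u) w = a * ip A u w.
Proof. by rewrite /ip -!scalemxAl mxE. Qed.

Lemma ipDr u v w : ip A u (v + w) = ip A u v + ip A u w.
Proof. by rewrite /ip linearD mulmxDr mxE. Qed.

Lemma ipZr a u w : ip A u (a *: w) = a * ip A u w.
Proof. by rewrite /ip linearZ -scalemxAr mxE. Qed.

Lemma ipBr u v w : ip A u (v - w) = ip A u v - ip A u w.
Proof. by rewrite ipDr -scaleN1r ipZr mulN1r. Qed.

Lemma ip_sym u v : A^T = A -> ip A u v = ip A v u.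
Proof.
move=> sA; rewrite /ip; have -> : u *m A *m v^T = (v *m A *m u^T)^T.
  by rewrite !trmx_mul trmxK sA mulmxA.
by rewrite mxE.
Qed.

Lemma ip_inj v w : A \in unitmx -> (forall u, ip A u v = ip A u w) -> v = w.
Proof.
move=> uA E; apply: trmx_inj; apply: (can_inj (mulKmx uA)); apply/colP => i.
by have := E (delta_mx 0 i); rewrite /ip -!mulmxA -!rowE !mxE.
Qed.

End BilinearForms.

(** Computes the same inner product from chart components, the only form in which smoothness of the
    data is given. *)
Lemma ip_change_basis (R : realType) n m (C F : 'M[R]_n) (C' F' : 'M[R]_m)
    (T : 'M[R]_(n, m)) (G : 'M[R]_m) (u : 'rV[R]_n) (v : 'rV[R]_m) :
  C *m F = 1%:M -> C' *m F' = 1%:M ->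
  (u *m C *m (F *m T *m C') *m (F' *m G *m F'^T) *m (v *m C')^T) 0 0 = ip G (u *m T) v.
Proof.
move=> CF CF'; have CFT : F'^T *m C'^T = 1%:M by rewrite -trmx_mul CF' trmx1.
rewrite /ip trmx_mul !mulmxA -(mulmxA u C) CF mulmx1 -(mulmxA _ C' F') CF' mulmx1.
by rewrite -(mulmxA _ F'^T C'^T) CFT mulmx1.
Qed.

(** * The difference of two dual connections as a symmetric bilinear map *)

Section StatisticalDifference.
Context (R : realType) (n : nat) (M : manifold R n) (g : tensor2 M).
Context (D Ds : vfield M -> vfield M -> vfield M).
Hypothesis stat : indefinite_statistical g D Ds.
Implicit Types (u v w : 'rV[R]_n) (p : M).

(** The tensor [D - Ds] at [p], evaluated on the extensions with constant components in [pref p]: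
    exactly the terms by which [cov_along] for [D] and for [Ds] differ. *)
Definition conn_diff p u v : 'rV[R]_n :=
  let c := pref p in
  D (coord_field c u) (coord_field c v) p - Ds (coord_field c u) (coord_field c v) p.

Lemma coord_field_pref p u : coord_field (pref p) u p = u.
Proof. by rewrite /coord_field frame_pref mulmx1. Qed.

Lemma cov_metric_diff p u v w :
  let X := coord_field (pref p) in
  cov_metric g D (X v) (X u) (X w) p = - ip (g p) u (conn_diff p v w).
Proof.
move=> X; have sX := smooth_coord_field (c := pref p).
rewrite /cov_metric (stat_dual stat (dom_open _) (sX v) (sX u) (sX w) (pref_dom p)).
by rewrite [X in X - _]addrAC subrr add0r ipBr opprB /metric /X coord_field_pref.
Qed.

Lemma ip_conn_diffC p u v w : ip (g p) u (conn_diff p v w) =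
  ip (g p) v (conn_diff p u w).
Proof.
have sX := smooth_coord_field (c := pref p).
apply: oppr_inj; rewrite -!cov_metric_diff.
exact: (stat_codazzi stat (dom_open _) (sX v) (sX u) (sX w) (pref_dom p)).
Qed.

(** Symmetry of [g] makes [cov_metric] symmetric in its last two arguments. With the Codazzi
    exchange this generates all permutations. *)
Lemma ip_conn_diffCA p u v w : ip (g p) u (conn_diff p v w) =
  ip (g p) w (conn_diff p v u).
Proof.
have mC (X Y : vfield M) : metric g X Y = metric g Y X.
  by apply/funext => q; exact/ip_sym/Defs.metric_sym/stat_metric/stat.
apply: oppr_inj; rewrite -!cov_metric_diff /cov_metric; set X := coord_field _.
by rewrite (mC (X w)) (mC (D _ _) (X u)) (mC (X w)) addrAC.
Qed.

(* The form g(u, T(v, w)) is totally symmetric, so T inherits the linearity of g(u, _). *)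
Lemma conn_diff_sym p u v : conn_diff p u v = conn_diff p v u.
Proof.
apply: (ip_inj (metric_nondegenerate (stat_metric stat) p)) => w.
by rewrite ip_conn_diffC ip_conn_diffCA ip_conn_diffC.
Qed.

Lemma conn_diff_linear p a u v w :
  conn_diff p (u + a *: v) w = conn_diff p u w + a *: conn_diff p v w.
Proof.
apply: (ip_inj (metric_nondegenerate (stat_metric stat) p)) => z.
by rewrite ipDr ipZr ip_conn_diffC ipDl ipZl !(ip_conn_diffC p z).
Qed.

End StatisticalDifference.

(** * Smoothness of inner products along a map *)

Section SmoothFieldsAlong.
Context (R : realType).

Lemma eq_smooth_field n (M : manifold R n) (U : set M) (X Y : vfield M) :
  open U -> (forall p, U p -> X p = Y p) -> smooth_field U X -> smooth_field U Y.
Proof.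
move=> oU XY sX i; apply: (eq_smooth_on (open_chart_image (i := i) oU) _ (sX i)).
by move=> _ [p [Up ip] <-] /=; rewrite (chartK ip) (XY p Up).
Qed.

(** In charts the function is a matrix product: components of [X], Jacobian of [f], Gram matrix
    along [f], transposed components of [N]. This yields smoothness of [eta]. *)
Lemma smooth_fun_ip_along n m (M : manifold R n) (M' : manifold R m) (f : M -> M')
    (g : tensor2 M') (U : set M) (X : vfield M) (N : afield f) :
  smooth_map f -> semi_riemannian g -> open U -> smooth_field U X -> smooth_along U N ->
  smooth_fun U (fun p => ip (g (f p)) (push f X p) (N p) : R^o).
Proof.
move=> sf sg oU sX sN i; apply: smooth_on_nbhs => _ [p [Up ip] <-].
(* One ambient chart need not cover the image of [U], so the argument is confined to the part of [U]
   that [f] sends into [dom j]. *)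
set j := pref (f p); pose V := U `&` f @^-1` dom j.
have oV : open V.
  by apply: openI => //; apply: (continuousP _).1; [exact: sf.1 | exact: dom_open].
exists (chart i @` (V `&` dom i)).
  by exists p => //; split=> //; split=> //; exact: pref_dom.
set A := chart i @` _; have oA : open A by exact: open_chart_image.
pose phi := chart j \o f \o inv i.
have sphi : smooth_on A phi.
  by apply: smooth_on_sub (sf.2 i j) => _ [q [[Uq jq] iq] <-]; exists q.
have oB : open (chart j @` dom j) by exact: codom_open.
have AB x : A x -> (chart j @` dom j) (phi x).
  by move=> [q [[Uq jq] iq] <-]; exists (f q); rewrite // /phi /= chartK.
have sG := smooth_on_comp oA oB sphi (metric_smooth sg (i := j)) AB.
have {}sX : smooth_on A ((fun q => X q *m comps i q) \o inv i).
  by apply: smooth_on_sub (sX i) => _ [q [[Uq jq] iq] <-]; exists q.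
have {}sN : smooth_on A ((fun q => N q *m comps j (f q)) \o inv i).
  by apply: smooth_on_sub (sN i j) => _ [q [[Uq jq] iq] <-]; exists q.
have sE := smooth_on_mulmx oA (smooth_on_mulmx oA (smooth_on_mulmx oA sX
  (smooth_on_jacobian oA sphi)) sG) (smooth_on_trmx oA sN).
apply: (eq_smooth_on oA _ (smooth_on_entry 0 0 oA sE)).
move=> _ [q [[Uq jq] iq] <-] /=; rewrite (chartK iq) -(frame_tmap_comps sf iq jq).
have -> : phi (chart i q) = chart j (f q) by rewrite /phi /= (chartK iq).
by rewrite (chartK jq) (ip_change_basis _ _ _ _ (compsK iq) (compsK jq)).
Qed.

End SmoothFieldsAlong.

(** * The splitting of the tangent spaces of a lightlike hypersurface *)

Section LightlikeHypersurface.
Context (R : realType) (n : nat) (Mbar : manifold R n.+1) (gbar : tensor2 Mbar).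
Context (D Ds : vfield Mbar -> vfield Mbar -> vfield Mbar).
Hypothesis stat : indefinite_statistical gbar D Ds.
Context (M : manifold R n) (f : M -> Mbar).
Hypothesis immersed : smooth_immersion f.
Context (S : subspaces M).
Hypothesis screen : screen_distribution gbar f S.
Context (W : set M) (oW : open W) (xi : vfield M).
Hypothesis xi_rad : section_of W (Rad gbar f) xi.
Hypothesis xi_neq0 : forall p, W p -> xi p != 0.
Context (N : afield f).
Hypothesis transversal : lightlike_transversal gbar S W xi N.
Implicit Types (X Y Z : vfield M) (p : M).

Lemma gbar_sym q : (gbar q)^T = gbar q.
Proof. exact: Defs.metric_sym (stat_metric stat) q. Qed.

Lemma immersion_smooth_map : smooth_map f.
Proof. by split; [exact: immersion_continuous | exact: immersion_smooth]. Qed.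

Lemma ip_push p (u v : 'rV[R]_n) :
  ip (gbar (f p)) (u *m tmap f p) (v *m tmap f p) = ip (induced_metric gbar f p) u v.
Proof. by rewrite /ip /induced_metric trmx_mul !mulmxA. Qed.

Lemma ip_push_xi p (u : 'rV[R]_n) : W p ->
  ip (gbar (f p)) (u *m tmap f p) (push f xi p) = 0.
Proof.
move=> Wp; rewrite ip_sym ?gbar_sym // ip_push /ip.
by have /sub_kermxP -> := xi_rad.2 p Wp; rewrite mul0mx mxE.
Qed.

(** Pairing with [xi] kills tangent vectors and reads off the coefficient of [N]; the tangent parts
    then agree because [f] is an immersion. *)
Lemma transversal_inj p (u v : 'rV[R]_n) b c : W p ->
  u *m tmap f p + b *: N p = v *m tmap f p + c *: N p -> u = v.
Proof.
move=> Wp E; apply: (row_free_inj (immersion_injective immersed p)).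
suff bc : b = c by move: E; rewrite bc => /addIr.
have := congr1 (fun w => ip (gbar (f p)) w (push f xi p)) E.
by rewrite !ipDl !ipZl !ip_push_xi // !add0r (transversal_xi transversal Wp) !mulr1.
Qed.

Lemma screen_xi_eq0 p a (u : 'rV[R]_n) : W p -> (u <= S p)%MS -> u = a *: xi p -> a = 0.
Proof.
move=> Wp uS uE; have : (u <= S p :&: Rad gbar f p)%MS.
  by rewrite sub_capmx uS uE scalemx_sub //; exact: xi_rad.2.
rewrite (screen_complement_cap screen) submx0 uE scaler_eq0.
by rewrite (negPf (xi_neq0 Wp)) orbF => /eqP.
Qed.

(** The screen has rank [n.-1] and is complementary to the radical, which therefore has rank one and
    is spanned by the nonzero [xi p]. *)
Lemma rad_xi p (u : 'rV[R]_n) : W p -> (u <= Rad gbar f p)%MS -> (u <= xi p)%MS.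
Proof.
(* For [n = 0] the truncated [n.-1] would spoil the rank count; a nonzero [xi p] excludes this
   case. *)
move=> Wp uR; have n0 : (0 < n)%N.
  case: (n) (xi p) (xi_neq0 Wp) => // v /eqP[]; exact: thinmx0.
have rS : \rank (S p) = n.-1.
  have [U [e [_ Up _ /(_ p Up) [F_free /eqmxP <-]]]] := screen_distr screen p.
  exact/eqP.
have rR : \rank (Rad gbar f p) = 1%N.
  apply/eqP; rewrite -(eqn_add2l n.-1) addn1 prednK // -{1}rS.
  rewrite -mxrank_disjoint_sum ?(screen_complement_cap screen) //.
  by rewrite (eqmxP (screen_complement_sum screen p)) mxrank1.
have /mxrank_leqif_sup := xi_rad.2 p Wp.
rewrite rR rank_rV xi_neq0 // => -[_ /esym Rxi].
by apply: submx_trans uR _; rewrite Rxi.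
Qed.

Local Notation P := (screen_proj gbar f S).
Local Notation eta := (eta_form gbar N).

Lemma screen_proj_sub X p : (P X p <= S p)%MS.
Proof. exact: proj_mx_sub. Qed.

(** The radical part is some [a *: xi p]; pairing with [N], which is orthogonal to the screen and
    has product 1 with [xi], gives [a = eta X p]. *)
Lemma screen_decomp X p : W p -> X p = P X p + eta X p *: xi p.
Proof.
move=> Wp.
have XE : X p = P X p + X p *m proj_mx (Rad gbar f p) (S p).
  rewrite add_proj_mx ?(screen_complement_cap screen) //.
  by rewrite (eqmxP (screen_complement_sum screen p)) submx1.
have /sub_rVP[a aE] := rad_xi Wp (proj_mx_sub (Rad gbar f p) (S p) (X p)).
suff -> : eta X p = a by rewrite -aE.
rewrite /eta_form ip_sym ?gbar_sym // /push XE aE mulmxDl ipDr.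
rewrite (transversal_screen transversal Wp (screen_proj_sub X p)) add0r.
by rewrite -scalemxAl ipZr (transversal_xi transversal Wp) mulr1.
Qed.

(** Smoothness is read off from [X - eta(X) xi] instead of the pointwise projection matrices. *)
Lemma smooth_screen_proj X : smooth_field W X -> smooth_field W (P X).
Proof.
move=> sX.
have se : smooth_fun W (eta X : M -> R^o).
  exact: smooth_fun_ip_along immersion_smooth_map (stat_metric stat) oW sX
    (transversal_smooth transversal).
have sxi := smooth_fieldZ oW (smooth_fun_cst (-1)) (smooth_fieldZ oW se xi_rad.1).
apply: (eq_smooth_field oW _ (smooth_fieldD oW sX sxi)) => p Wp.
by rewrite /= {1}(screen_decomp X Wp) scaleN1r addrK.
Qed.

Lemma section_screen_proj X : smooth_field W X -> section_of W S (P X).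
Proof.
by move=> sX; split=> [|p _];
  [exact: smooth_screen_proj | exact: screen_proj_sub].
Qed.

(** * The difference tensor of the induced connections *)

Section DifferenceTensor.
Context (nabla nablas : vfield M -> vfield M -> vfield M).
Context (B Bs : vfield M -> vfield M -> M -> R).
Hypothesis gauss : gauss_formula D W N nabla B.
Hypothesis gausss : gauss_formula Ds W N nablas Bs.

Local Notation K := (difference_tensor nabla nablas).

(* In the difference of the two Gauss formulas the derivatives of the components
   of Y cancel, which makes K pointwise. *)
Lemma push_difference X Y p : smooth_field W X -> smooth_field W Y -> W p ->
  exists b, K X Y p *m tmap f p + b *: N p =
    2^-1 *: conn_diff D Ds (f p) (push f X p) (push f Y p).
Proof.
move=> sX sY Wp; exists (2^-1 * (B X Y p - Bs X Y p)).
rewrite /difference_tensor -scalemxAl -scalerA -scalerDr; congr (_ *: _).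
have -> : conn_diff D Ds (f p) (push f X p) (push f Y p) =
    cov_along D X (push f Y) p - cov_along Ds X (push f Y) p.
  by rewrite /cov_along opprD addrACA subrr add0r.
by rewrite (gauss sX sY Wp) (gausss sX sY Wp) opprD addrACA mulmxBl scalerBl.
Qed.

Lemma difference_sym X Y p : smooth_field W X -> smooth_field W Y -> W p ->
  K X Y p = K Y X p.
Proof.
move=> sX sY Wp; have [b Eb] := push_difference sX sY Wp.
have [c Ec] := push_difference sY sX Wp.
apply: (@transversal_inj p _ _ b c Wp).
by rewrite Eb (conn_diff_sym stat) -Ec.
Qed.

(** The relation between the fields is assumed at [p] only, so this includes tensoriality and
    applies with [a] the value of [eta X] at [p]. *)
Lemma difference_linear_l X X' X'' Y a p :
  smooth_field W X -> smooth_field W X' -> smooth_field W X'' -> smooth_field W Y ->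
  W p -> X p = X' p + a *: X'' p -> K X Y p = K X' Y p + a *: K X'' Y p.
Proof.
move=> sX sX' sX'' sY Wp XE; have [b Eb] := push_difference sX sY Wp.
have [b' Eb'] := push_difference sX' sY Wp.
have [b'' Eb''] := push_difference sX'' sY Wp.
apply: (@transversal_inj p _ _ b (b' + a * b'') Wp).
rewrite Eb mulmxDl -scalemxAl scalerDl -scalerA addrACA -scalerDr Eb' Eb''.
rewrite /push XE mulmxDl -scalemxAl (conn_diff_linear stat) scalerDr.
by rewrite !scalerA mulrC.
Qed.

Lemma difference_linear_r X Y Y' Y'' a p :
  smooth_field W X -> smooth_field W Y -> smooth_field W Y' -> smooth_field W Y'' ->
  W p -> Y p = Y' p + a *: Y'' p -> K X Y p = K X Y' p + a *: K X Y'' p.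
Proof.
move=> sX sY sY' sY'' Wp YE; rewrite !(difference_sym sX) //.
exact: difference_linear_l.
Qed.

Lemma section_difference (E : subspaces M) X Y :
  section_of W E (nabla X Y) -> section_of W E (nablas X Y) -> section_of W E (K X Y).
Proof.
move=> [s1 E1] [s2 E2]; split=> [|p Wp]; last first.
  by rewrite scalemx_sub // addmx_sub ?E1 // eqmx_opp E2.
have s2' := smooth_fieldZ oW (smooth_fun_cst (-1)) s2.
have sK := smooth_fieldZ oW (smooth_fun_cst 2^-1) (smooth_fieldD oW s1 s2').
apply: (eq_smooth_field oW _ sK).
by move=> p _; rewrite /= scaleN1r.
Qed.

Hypothesis rad_parallel : parallel W nabla (Rad gbar f).
Hypothesis rad_parallels : parallel W nablas (Rad gbar f).
Hypothesis screen_parallel : parallel W nabla S.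
Hypothesis screen_parallels : parallel W nablas S.

(* Parallelism puts K(Z, xi) in Rad and K(xi, Z) in the screen. *)
Lemma difference_screen_xi Z p : section_of W S Z -> W p -> K Z xi p = 0.
Proof.
move=> ZS Wp; have [_ KR] := section_difference
  (rad_parallel ZS.1 xi_rad) (rad_parallels ZS.1 xi_rad).
have [_ KS] := section_difference
  (screen_parallel xi_rad.1 ZS) (screen_parallels xi_rad.1 ZS).
apply/eqP; rewrite -submx0 -(screen_complement_cap screen p) sub_capmx KR // andbT.
by rewrite (difference_sym ZS.1 xi_rad.1) // KS.
Qed.

Lemma difference_xi X p : smooth_field W X -> W p -> K X xi p = eta X p *: K xi xi p.
Proof.
move=> sX Wp; have [sPX _] := section_screen_proj sX.
rewrite (difference_linear_l sX sPX xi_rad.1 xi_rad.1 Wp (screen_decomp X Wp)).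
by rewrite difference_screen_xi ?add0r //; exact: section_screen_proj.
Qed.

(** Expansion in [Y], then in [X], along the splitting; the mixed terms pair [xi] with a screen
    section and vanish. *)
Lemma difference_decomp X Y p : smooth_field W X -> smooth_field W Y -> W p ->
  K X Y p = K (P X) (P Y) p + (eta X p * eta Y p) *: K xi xi p.
Proof.
move=> sX sY Wp; have sPX := smooth_screen_proj sX; have sPY := smooth_screen_proj sY.
rewrite (difference_linear_r sX sY sPY xi_rad.1 Wp (screen_decomp Y Wp)).
rewrite difference_xi // scalerA mulrC; congr (_ + _).
rewrite (difference_linear_l sX sPX xi_rad.1 sPY Wp (screen_decomp X Wp)).
rewrite -(difference_sym sPY xi_rad.1) // difference_screen_xi ?scaler0 ?addr0 //.
exact: section_screen_proj.
Qed.

Context (A As : vfield M -> vfield M) (tau taus : vfield M -> M -> R).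
Hypothesis decomp : xi_decomposition W S xi nabla A tau.
Hypothesis decomps : xi_decomposition W S xi nablas As taus.

(** Compares the coefficients of [xi] in [K X xi = eta X *: K xi xi], after both sides are written
    through [A], [As], [tau] and [taus]. *)
Lemma tau_difference X p : smooth_field W X -> W p ->
  tau X p - taus X p = (tau xi p - taus xi p) * eta X p.
Proof.
move=> sX Wp; have [AX DX] := decomp sX Wp; have [AsX DsX] := decomps sX Wp.
have [Axi Dxi] := decomp xi_rad.1 Wp; have [Asxi Dsxi] := decomps xi_rad.1 Wp.
have := difference_xi sX Wp; rewrite /difference_tensor DX DsX Dxi Dsxi.
rewrite scalerA mulrC -scalerA => /scalerI; rewrite invr_eq0 pnatr_eq0 => /(_ isT) E.
apply/eqP; rewrite -subr_eq0 mulrC; apply/eqP; set e := eta X p in E *.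
(* The screen part of the identity [E]. It equals the claimed difference times [xi p], and a screen
   vector proportional to [xi p] has coefficient zero. *)
pose s := (As X p - A X p) - e *: (As xi p - A xi p).
have sS : (s <= S p)%MS.
  by rewrite !(addmx_sub, eqmx_opp, scalemx_sub).
apply: (screen_xi_eq0 Wp sS); rewrite /s.
have diff_split a b u v :
    (- u - a *: xi p) - (- v - b *: xi p) = (v - u) - (a - b) *: xi p.
  by rewrite !opprD !opprK addrACA [- u + v]addrC scalerBl opprB [_ + b *: _]addrC.
move: E; rewrite !diff_split scalerBr scalerA => /eqP.
rewrite subr_eq => /eqP ->.
by rewrite [RHS]scalerBl addrAC [X in X + _]addrAC subrr add0r addrC.
Qed.

End DifferenceTensor.
End LightlikeHypersurface.

Unset Implicit Arguments.
Set Strict Implicit.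

Theorem theorem3p5 (R : realType) (n : nat)
    (Mbar : manifold R n.+1) (gbar : tensor2 Mbar)
    (Dbar Dbars : vfield Mbar -> vfield Mbar -> vfield Mbar)
    (hMbar : indefinite_statistical gbar Dbar Dbars)
    (M : manifold R n) (f : M -> Mbar)
    (hM : lightlike_hypersurface gbar f)
    (S : subspaces M) (hS : screen_distribution gbar f S)
    (W : set M) (hW : open W)
    (xi : vfield M) (hxi : section_of W (Rad gbar f) xi)
    (hxi0 : forall p, W p -> xi p != 0)
    (N : afield f) (hN : lightlike_transversal gbar S W xi N)
    (nabla nablas : vfield M -> vfield M -> vfield M)
    (B Bs : vfield M -> vfield M -> M -> R)
    (hgauss : gauss_formula Dbar W N nabla B)
    (hgausss : gauss_formula Dbars W N nablas Bs)
    (A As : vfield M -> vfield M) (tau taus : vfield M -> M -> R)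
    (htau : xi_decomposition W S xi nabla A tau)
    (htaus : xi_decomposition W S xi nablas As taus)
    (hRad : parallel W nabla (Rad gbar f))
    (hRads : parallel W nablas (Rad gbar f))
    (hScr : parallel W nabla S)
    (hScrs : parallel W nablas S) :
  let K := difference_tensor nabla nablas in
  let P := screen_proj gbar f S in
  let eta := eta_form gbar N in
  [/\ forall Z : vfield M, section_of W S Z -> forall p, W p ->
        K Z xi p = 0 /\ K xi Z p = 0,
      forall X Y : vfield M, smooth_field W X -> smooth_field W Y ->
        [/\ forall p, W p ->
              K X Y p = K (P X) (P Y) p + (eta X p * eta Y p) *: K xi xi p,
            section_of W S (K (P X) (P Y)) &
            section_of W (Rad gbar f) (K xi xi)],
      forall Z : vfield M, section_of W S Z -> forall p, W p ->
        tau Z p - taus Z p = 0 &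
      forall X : vfield M, smooth_field W X -> forall p, W p ->
        tau X p - taus X p = (tau xi p - taus xi p) * eta X p].
Proof.
move=> K P eta; split.
- move=> Z ZS p Wp; have KZ : K Z xi p = 0.
    exact: (difference_screen_xi hMbar hM.1 hS hW hxi hN hgauss hgausss).
  split=> //; rewrite -[RHS]KZ; apply/esym.
  exact: (difference_sym hMbar hM.1 hxi hN hgauss hgausss ZS.1 hxi.1 Wp).
- move=> X Y sX sY; split=> [p Wp||].
  + exact: (difference_decomp hMbar hM.1 hS hW hxi hxi0 hN hgauss hgausss).
  + have PX := section_screen_proj hMbar hM.1 hS hW hxi hxi0 hN sX.
    have PY := section_screen_proj hMbar hM.1 hS hW hxi hxi0 hN sY.
    have := section_difference hW (hScr _ _ PX.1 PY) (hScrs _ _ PX.1 PY).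
    exact.
  + have := section_difference hW (hRad _ _ hxi.1 hxi) (hRads _ _ hxi.1 hxi).
    exact.
- move=> Z ZS p Wp.
  rewrite (tau_difference hMbar hM.1 hS hW hxi hxi0 hN hgauss hgausss
    hRad hRads hScr hScrs htau htaus ZS.1 Wp).
  (* [eta] vanishes on the screen because [N] is orthogonal to it. *)
  rewrite /eta_form (ip_sym _ _ (gbar_sym hMbar (f p))).
  by rewrite (transversal_screen hN Wp (ZS.2 p Wp)) mulr0.
- move=> X sX p Wp.
  exact: (tau_difference hMbar hM.1 hS hW hxi hxi0 hN hgauss hgausss
    hRad hRads hScr hScrs htau htaus sX Wp).
Qed.
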